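(* Let $\mathcal P\subseteq\mathbf{AF}$ be a hereditary property of arrow finite quivers such that there exists at least one finite quiver not carrying the property $\mathcal P$. Then $\mathcal P\cap\mathbf{LF}$ is not dense in $\mathbf{LF}$, and $\mathcal P$ is not dense in $\mathbf{AF}$. On the other hand, $\mathbf{LF}\setminus\mathcal P$ is dense in $\mathbf{LF}$ and $\mathbf{AF}\setminus\mathcal P$ is dense in $\mathbf{AF}$. Moreover, $\mathcal P=\mathcal P_{\mathcal F}$ for some (possibly infinite) family $\mathcal F$ of finite unlabeled quivers if and only if $\mathcal P$ is closed in $\mathbf{AF}$.
   Context: A quiver on a set $X$ is a function $Q:X\times X\to\mathbb{Z}$ with $Q(x,y)=-Q(y,x)$ for all $x,y$. $\mathbf{AF}^X$ is the set of all quivers on $X$; $Q$ is locally finite if $\sum_{y}|Q(x,y)|<\infty$ for all $x$, and finite if $\sum_{x,y}|Q(x,y)|<\infty$. For $V\subseteq X$, $\rho_V(Q)(x,y)=Q(x,y)$ if $x,y\in V$ and $0$ otherwise (restriction; $\rho_V(Q)$ is called a full subquiver of $Q$, finite if $V$ is finite); $\lambda_V(Q)(x,y)=Q(x,y)$ if $x\in V$ or $y\in V$ and $0$ otherwise. For $Q\in\mathbf{AF}^X$, finite $V\subseteq X$: $U_{Q,V}=\{Q':\rho_V(Q')=\rho_V(Q)\}$, $W_{Q,V}=\{Q':\lambda_V(Q')=\lambda_V(Q)\}$. $\mathbb{N}$ is the positive integers. $\mathbf{AF}$ denotes $\mathbf{AF}^{\mathbb{N}}$ with the topology generated by the basis $\{U_{Q,V}\}$;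 $\mathbf{LF}$ denotes the set of locally finite quivers on $\mathbb{N}$ with the topology generated by the basis $\{W_{Q,V}\cap\mathbf{LF}\}$. A property of quivers is a subset $\mathcal P\subseteq\mathbf{AF}$ invariant under relabeling vertices (i.e. under isomorphism). $\mathcal P$ is hereditary if whenever $Q\in\mathcal P$, every finite full subquiver of $Q$ also lies in $\mathcal P$. For a family $\mathcal F$ of finite unlabeled quivers (isomorphism classes of quivers on finite vertex sets), $\mathcal P_{\mathcal F}$ is the set of $Q\in\mathbf{AF}$ such that for no finite $V\subseteq\mathbb{N}$ is the quiver $Q|_{V\times V}$ on $V$ isomorphic to a member of $\mathcal F$. *)

(* Defs.v *)
From HB Require Import structures.
From mathcomp Require Import all_boot all_order all_algebra.
From mathcomp Require Import all_classical all_reals all_analysis.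
From mathcomp Require Import Rstruct.

Set Implicit Arguments.
Unset Strict Implicit.
Unset Printing Implicit Defensive.

Import Order.TTheory GRing.Theory Num.Theory.

Local Open Scope classical_set_scope.
Local Open Scope ring_scope.

Record quiver (X : Type) := Quiver {
  arrows :> X -> X -> int;
  arrows_anti : forall x y, arrows x y = - arrows y x }.

Definition isomorphic (X Y : Type) (Q : quiver X) (Q' : quiver Y) : Prop :=
  exists2 f : X -> Y, bijective f & forall x y, Q' (f x) (f y) = Q x y.

Lemma quiver0_anti (X : Type) : forall x y : X, 0 = - 0 :> int.
Proof. by move=> _ _; rewrite oppr0. Qed.

Definition quiver0 (X : Type) : quiver X := Quiver (@quiver0_anti X).

HB.instance Definition _ (X : Type) := gen_eqMixin (quiver X).
HB.instance Definition _ (X : Type) := gen_choiceMixin (quiver X).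
HB.instance Definition _ (X : Type) := isPointed.Build (quiver X) (quiver0 X).

Section Restrictions.
Variables (X : Type) (V : set X) (Q : quiver X).

Lemma rho_anti x y :
  (if (x \in V) && (y \in V) then Q x y else 0) =
  - (if (y \in V) && (x \in V) then Q y x else 0).
Proof. by rewrite andbC; case: ifP; rewrite ?oppr0 // -arrows_anti. Qed.

Definition rho : quiver X := Quiver rho_anti.

Lemma lambda_anti x y :
  (if (x \in V) || (y \in V) then Q x y else 0) =
  - (if (y \in V) || (x \in V) then Q y x else 0).
Proof. by rewrite orbC; case: ifP; rewrite ?oppr0 // -arrows_anti. Qed.

Definition lambda : quiver X := Quiver lambda_anti.

(* Unlike [rho], whose vertex set is still X, this is the quiver Q|_(V x V)
   whose vertices are the elements of V. *)
Definition induced : quiver (set_type V) :=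
  Quiver (fun x y => arrows_anti Q (val x) (val y)).

End Restrictions.

Lemma rhoE (X : Type) (V : set X) (Q : quiver X) x y :
  rho V Q x y = if (x \in V) && (y \in V) then Q x y else 0.
Proof. by []. Qed.

Lemma lambdaE (X : Type) (V : set X) (Q : quiver X) x y :
  lambda V Q x y = if (x \in V) || (y \in V) then Q x y else 0.
Proof. by []. Qed.

Lemma quiverP (X : Type) (Q Q' : quiver X) :
  (forall x y, Q x y = Q' x y) -> Q = Q'.
Proof.
case: Q Q' => [a ha] [b hb] /= ab.
have {}ab : a = b by apply/funext => x; apply/funext => y.
by case: _ / ab in hb *; congr Quiver; exact: Prop_irrelevance.
Qed.

Lemma rho_sub (X : Type) (V W : set X) (Q Q' : quiver X) :
  V `<=` W -> rho W Q = rho W Q' -> rho V Q = rho V Q'.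
Proof.
move=> VW e; apply: quiverP => x y; rewrite !rhoE.
have := congr1 (fun q : quiver X => q x y) e; rewrite !rhoE.
case: (boolP ((x \in V) && (y \in V))) => // /andP[/set_mem Vx /set_mem Vy].
by rewrite !mem_set //; exact: VW.
Qed.

Lemma lambda_sub (X : Type) (V W : set X) (Q Q' : quiver X) :
  V `<=` W -> lambda W Q = lambda W Q' -> lambda V Q = lambda V Q'.
Proof.
move=> VW e; apply: quiverP => x y; rewrite !lambdaE.
have := congr1 (fun q : quiver X => q x y) e; rewrite !lambdaE.
case: (boolP ((x \in V) || (y \in V))) => // /orP[] /set_mem Vz;
  by rewrite (mem_set (VW _ Vz)) ?orbT.
Qed.

Definition arrow_finite_nbhd (X : Type) (i : quiver X * set X) :
    set (quiver X) :=
  [set Q' | rho i.2 Q' = rho i.2 i.1].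

Lemma arrow_finite_nbhd_cover (X : Type) :
  \bigcup_(i in [set i | finite_set i.2]) @arrow_finite_nbhd X i = setT.
Proof.
by apply/seteqP; split=> // Q _; exists (Q, set0) => //=; exact: finite_set0.
Qed.

Lemma arrow_finite_nbhd_join (X : Type) (i j : quiver X * set X) Q :
  finite_set i.2 -> finite_set j.2 ->
  arrow_finite_nbhd i Q -> arrow_finite_nbhd j Q ->
  exists k, [/\ finite_set k.2, arrow_finite_nbhd k Q &
    arrow_finite_nbhd k `<=` arrow_finite_nbhd i `&` arrow_finite_nbhd j].
Proof.
move=> fi fj iQ jQ; exists (Q, i.2 `|` j.2); split => //=.
  by rewrite finite_setU.
move=> Q' /= e; split; rewrite /arrow_finite_nbhd /=.
- by rewrite -iQ; apply: rho_sub e; exact: subsetUl.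
- by rewrite -jQ; apply: rho_sub e; exact: subsetUr.
Qed.

HB.instance Definition _ (X : Type) :=
  @isBaseTopological.Build (quiver X) (quiver X * set X)%type
    [set i | finite_set i.2] (@arrow_finite_nbhd X)
    (@arrow_finite_nbhd_cover X) (@arrow_finite_nbhd_join X).

Definition arrow_weight (X : Type) (Q : quiver X) (x y : X) :
    \bar Rdefinitions.R := ((Q x y)%:~R)%:E.

Definition locally_finite (X : choiceType) (Q : quiver X) : Prop :=
  forall x, summable [set: X] (arrow_weight Q x).

Definition finite_quiver (X : choiceType) (Q : quiver X) : Prop :=
  summable [set: X * X] (fun p => arrow_weight Q p.1 p.2).

(* A record rather than a [set_type]: the latter carries the subspace topology
   inherited from [quiver X], which is not the topology wanted here. *)
Record lf_quiver (X : choiceType) := LfQuiver {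
  lf_val :> quiver X;
  lf_valP : locally_finite lf_val }.

HB.instance Definition _ (X : choiceType) := gen_eqMixin (lf_quiver X).
HB.instance Definition _ (X : choiceType) := gen_choiceMixin (lf_quiver X).

Definition locally_finite_nbhd (X : choiceType) (i : quiver X * set X) :
    set (lf_quiver X) :=
  [set Q' : lf_quiver X | lambda i.2 Q' = lambda i.2 i.1].

Lemma locally_finite_nbhd_cover (X : choiceType) :
  \bigcup_(i in [set i | finite_set i.2]) @locally_finite_nbhd X i = setT.
Proof.
apply/seteqP; split=> // Q _.
by exists (lf_val Q, set0) => //=; exact: finite_set0.
Qed.

Lemma locally_finite_nbhd_join (X : choiceType) (i j : quiver X * set X) Q :
  finite_set i.2 -> finite_set j.2 ->
  locally_finite_nbhd i Q -> locally_finite_nbhd j Q ->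
  exists k, [/\ finite_set k.2, locally_finite_nbhd k Q &
    locally_finite_nbhd k `<=` locally_finite_nbhd i `&` locally_finite_nbhd j].
Proof.
move=> fi fj iQ jQ; exists (lf_val Q, i.2 `|` j.2); split => //=.
  by rewrite finite_setU.
move=> Q' /= e; split; rewrite /locally_finite_nbhd /=.
- by rewrite -iQ; apply: lambda_sub e; exact: subsetUl.
- by rewrite -jQ; apply: lambda_sub e; exact: subsetUr.
Qed.

HB.instance Definition _ (X : choiceType) :=
  @isBaseTopological.Build (lf_quiver X) (quiver X * set X)%type
    [set i | finite_set i.2] (@locally_finite_nbhd X)
    (@locally_finite_nbhd_cover X) (@locally_finite_nbhd_join X).

Definition posnat : countType := {n : nat | (0 < n)%N}.

Notation AF := (quiver posnat).
Notation LF := (lf_quiver posnat).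

Definition quiver_property (P : set AF) : Prop :=
  forall Q Q' : AF, isomorphic Q Q' -> P Q -> P Q'.

Definition hereditary (P : set AF) : Prop :=
  forall (Q : AF) (V : set posnat), finite_set V -> P Q -> P (rho V Q).

Record fin_quiver := FinQuiver {
  vertices : finType;
  fin_quiver_val :> quiver vertices }.

(* Classes of finite quivers are plain predicates because [set] cannot be
   applied to [fin_quiver], for universe reasons. *)
Definition isomorphism_class (G : fin_quiver) : fin_quiver -> Prop :=
  fun H => isomorphic G H.

Record unlabeled_quiver := UnlabeledQuiver {
  representative : fin_quiver -> Prop;
  representativeP : exists G, representative = isomorphism_class G }.

Definition avoiding (F : unlabeled_quiver -> Prop) : set AF :=
  [set Q : AF | ~ exists V : set posnat, finite_set V /\
     exists2 C, F C &
       exists2 G, representative C G & isomorphic (induced V Q) G].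

(* Main.v *)
Require Import Defs.
From HB Require Import structures.
From mathcomp Require Import all_boot all_order all_algebra.
From mathcomp Require Import finmap.
From mathcomp Require Import all_classical all_reals all_analysis.

Import Order.TTheory GRing.Theory Num.Theory.

Local Open Scope classical_set_scope.

(* Every question about P reduces to finite full subquivers. If rho V Q lies
   outside P for some finite V, heredity keeps the whole neighbourhood of Q cut
   out by V outside P. Conversely, since the vertex set is infinite, a copy of
   V can be moved away from any finite W, so that a copy of rho V Q can be
   planted in a given quiver without touching an arrow incident to W: quivers
   outside P are dense. If P is closed, its complement is a union of sets
   {Q' | rho V Q' = rho V Q}, whence P is defined by avoiding the finite
   quivers Q|_(V x V) with rho V Q outside P; that an isomorphism between two
   such Q|_(V x V) extends to a relabelling of all vertices is what makes this
   description consistent. *)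

Set Implicit Arguments.
Unset Strict Implicit.

(** * Isomorphisms, splicing and restriction *)

Section Isomorphism.
Variables X Y Z : Type.

Lemma isomorphic_sym (Q : quiver X) (Q' : quiver Y) :
  isomorphic Q Q' -> isomorphic Q' Q.
Proof.
case=> f [g fK gK] fE; exists g; first by exists f.
by move=> x y; rewrite -fE !gK.
Qed.

Lemma isomorphic_trans (Q : quiver X) (Q' : quiver Y) (Q'' : quiver Z) :
  isomorphic Q Q' -> isomorphic Q' Q'' -> isomorphic Q Q''.
Proof.
case=> f fbij fE [g gbij gE]; exists (g \o f); first exact: bij_comp.
by move=> x y; rewrite /= gE fE.
Qed.

End Isomorphism.

Definition pullback (X Y : Type) (h : Y -> X) (Q : quiver X) : quiver Y :=
  Quiver (fun x y => arrows_anti Q (h x) (h y)).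

Lemma splice_anti (X : Type) (V : set X) (Q Q' : quiver X) x y :
  (if (x \in V) || (y \in V) then Q x y else Q' x y) =
  (- (if (y \in V) || (x \in V) then Q y x else Q' y x))%R.
Proof. by rewrite orbC; case: ifP => _; exact: arrows_anti. Qed.

(** Overwrites [Q] only away from [V], so the result stays in the basic neighbourhood of [Q] cut out
    by [V], in either topology. *)
Definition splice (X : Type) (V : set X) (Q Q' : quiver X) : quiver X :=
  Quiver (splice_anti V Q Q').

Lemma rho_eqP (X : Type) (V : set X) (Q Q' : quiver X) :
  rho V Q = rho V Q' <-> forall x y, V x -> V y -> Q x y = Q' x y.
Proof.
split=> [e x y Vx Vy|e].
  have := congr1 (fun q : quiver X => q x y) e.
  by rewrite !rhoE !(mem_set Vx) !(mem_set Vy).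
apply: quiverP => x y; rewrite !rhoE.
by case: ifP => // /andP[/set_mem Vx /set_mem Vy]; exact: e.
Qed.

Lemma rho_lambda_eq (X : Type) (V : set X) (Q Q' : quiver X) :
  lambda V Q = lambda V Q' -> rho V Q = rho V Q'.
Proof.
move=> e; apply/rho_eqP => x y Vx Vy.
have := congr1 (fun q : quiver X => q x y) e.
by rewrite !lambdaE (mem_set Vx).
Qed.

Lemma lambda_splice (X : Type) (V : set X) (Q Q' : quiver X) :
  lambda V (splice V Q Q') = lambda V Q.
Proof. by apply: quiverP => x y; rewrite !lambdaE /=; case: (_ || _). Qed.

Lemma rho_idem (X : Type) (V : set X) (Q : quiver X) :
  rho V (rho V Q) = rho V Q.
Proof. by apply/rho_eqP => x y Vx Vy; rewrite rhoE !mem_set. Qed.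

Lemma isomorphic_rho (X Y : Type) (f : X -> Y) (V : set X)
    (Q : quiver X) (Q' : quiver Y) :
  bijective f -> (forall x y, V x -> V y -> Q' (f x) (f y) = Q x y) ->
  isomorphic (rho V Q) (rho (f @` V) Q').
Proof.
move=> fbij fE; exists f => // x y.
have fV z : (f z \in f @` V) = (z \in V).
  apply/idP/idP => [/set_mem[t Vt /(bij_inj fbij) <-]|/set_mem Vz].
    exact: mem_set.
  by apply: mem_set; exists z.
rewrite !rhoE !fV.
by case: ifP => // /andP[/set_mem Vx /set_mem Vy]; exact: fE.
Qed.

(* Outside V and g(V) there are countably infinitely many points left on both
   sides, and any matching of these completes g. *)
Lemma extend_injection (T : countType) (V : set T) (g : T -> T) :
  infinite_set [set: T] -> finite_set V -> set_inj V g ->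
  exists2 f : T -> T, bijective f & forall x, V x -> f x = g x.
Proof.
move=> Tinf Vfin ginj.
have cC (A : set T) : finite_set A -> (~` A #= [set: nat])%card.
  move=> Afin; apply: eq_card_nat; first exact: countableP.
  by rewrite -setTD; exact: infinite_setD.
have gVfin : finite_set (g @` V) by exact: finite_image.
have [x0 _] := infinite_setN0 Tinf.
pose pT : pointedType := HB.pack T (isPointed.Build T x0).
have /(@card_set_bijP T pT)[h [hfun hinj hsurj]] : (~` V #= ~` (g @` V))%card.
  by apply: card_eq_trans (cC _ Vfin) _; rewrite card_eq_sym; exact: cC.
pose f x := if x \in V then g x else h x.
have fV x : V x -> f x = g x by move=> Vx; rewrite /f mem_set.
have fC x : ~ V x -> f x = h x by move=> Vx; rewrite /f memNset.
exists f => //; rewrite -setTT_bijective; split => //.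
  move=> x y _ _.
  have [Vx|Vx] := pselect (V x); have [Vy|Vy] := pselect (V y).
  - by rewrite !fV //; apply: ginj; exact: mem_set.
  - by rewrite fV // fC // => e; case: (hfun _ Vy); exists x.
  - by rewrite fC // fV // => e; case: (hfun _ Vx); exists y.
  - by rewrite !fC //; apply: hinj; exact: mem_set.
move=> y _; have [[x Vx <-]|/hsurj[x Vx <-]] := pselect ((g @` V) y).
  by exists x; rewrite ?fV.
by exists x; rewrite ?fC.
Qed.

Lemma infinite_posnat : infinite_set [set: posnat].
Proof.
move=> /(finite_image (fun p : posnat => (val p).-1)).
apply: contra_not infinite_nat.
apply: sub_finite_set => n _.
by exists (exist (fun m => (0 < m)%N) n.+1 isT).
Qed.

(** A bijection from [V] to [W] is in particular an injection of [V] into [T]; completed to a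
    permutation of [T], it carries one restriction to the other. This turns isomorphisms of small
    quivers into relabellings. *)
Lemma induced_isomorphic_rho (T : countType) (V W : set T)
    (Q Q' : quiver T) :
  infinite_set [set: T] -> finite_set V ->
  isomorphic (Defs.induced V Q) (Defs.induced W Q') ->
  isomorphic (rho V Q) (rho W Q').
Proof.
move=> Tinf Vfin [f fbij fE].
(* The value outside [V] is a dummy: only the restriction of [g] to [V] gets extended. *)
pose g (x : T) : T :=
  if insub x is Some u then val (f (u : set_type V)) else x.
have gE (u : set_type V) : g (val u) = val (f u) by rewrite /g valK.
have gE' x (Vx : V x) : g x = val (f (SigSub (mem_set Vx))) by rewrite -gE.
have ginj : set_inj V g.
  move=> x y /set_mem Vx /set_mem Vy; rewrite !gE' => /val_inj/(bij_inj fbij).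
  by move/(congr1 val).
have [h hbij hE] := extend_injection Tinf Vfin ginj.
have -> : W = h @` V.
  apply/seteqP; split => [y Wy|_ [x Vx <-]].
    have [k fK kK] := fbij.
    pose u := k (SigSub (mem_set Wy)).
    have Vu : V (val u) by exact: set_mem (valP u).
    by exists (val u) => //; rewrite hE // gE kK.
  by rewrite hE // gE'; exact: set_mem (valP _).
apply: isomorphic_rho => // x y Vx Vy.
by rewrite !hE // !gE'; exact: fE.
Qed.

(** * Summability as finiteness of support *)

(** A nonzero integer has absolute value at least 1, so an infinite support forces the sum to
    diverge. *)
Lemma summable_intP (R : realType) (T : choiceType) (f : T -> int) :
  summable [set: T] (fun t => ((f t)%:~R)%:E : \bar R) <->
  finite_set [set t | f t != 0%R].
Proof.
split=> [fsum|ffin].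
  apply: contrapT => Sinf.
  suff : (+oo <= esum [set: T] (fun t => `|((f t)%:~R)%:E : \bar R|))%E.
    by rewrite leNgt => /negP; apply.
  rewrite leye_eq; apply/eqP/eqyP => r r0; apply: esum_ge.
  (* Enough points of the support that a term of size at least 1 at each already exceeds [r]. *)
  have [B BS] := infinite_set_fset (Num.bound r) Sinf.
  move=> nB; exists [set` B]; first by split=> //; exact: finite_fset.
  rewrite fsbig_finite ?finite_fset //= set_fsetK.
  apply: (@le_trans _ _ (\sum_(t <- B) (1%R)%:E)%E); last first.
    rewrite big_seq [leRHS]big_seq; apply: lee_sum => t tB.
    rewrite lee_fin -intr_norm ler1z -gtz0_ge1 normr_gt0.
    exact: (BS _ tB).
  rewrite sumEFin lee_fin big_const_seq iter_addr_0 count_predT.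
  by apply: ltW; apply: lt_le_trans (archi_boundP (ltW r0)) _; rewrite ler_nat.
rewrite /summable (_ : esum _ _ =
    esum [set t | f t != 0%R] (fun t => `|((f t)%:~R)%:E : \bar R|%E)).
  rewrite esum_fset // fsbig_finite //=.
  by apply/lte_sum_pinfty => t _; rewrite /= ltry.
rewrite [RHS]esum_mkcond; apply: eq_esum => t _.
case: ifPn => // /negP ft.
have -> : f t = 0%R by apply/eqP/negPn/negP => e; apply: ft; exact: mem_set.
by rewrite abse0.
Qed.

Lemma finite_quiver_rho (X : choiceType) (Q : quiver X) :
  finite_quiver Q -> exists2 V, finite_set V & rho V Q = Q.
Proof.
move/(summable_intP _ (fun p : X * X => Q p.1 p.2)) => Sfin.
(* First coordinates suffice: by antisymmetry the support is symmetric. *)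
exists (fst @` [set p : X * X | Q p.1 p.2 != 0%R]).
  exact: finite_image.
have supp x y : Q x y != 0%R -> (fst @` [set p : X * X | Q p.1 p.2 != 0%R]) x.
  by move=> Qxy; exists (x, y).
apply: quiverP => x y; rewrite rhoE.
have [Qxy|/supp Vx] := eqVneq (Q x y) 0%R; first by rewrite Qxy if_same.
have [Qyx|/supp Vy] := eqVneq (Q y x) 0%R.
  by rewrite arrows_anti Qyx oppr0 if_same.
by rewrite !mem_set.
Qed.

(** * Basic open sets of the two topologies *)

Lemma arrow_finite_nbhd_open (X : Type) (V : set X) (Q : quiver X) :
  finite_set V -> open [set Q' : quiver X | rho V Q' = rho V Q].
Proof.
by move=> Vfin; exists [set (Q, V)]; [move=> _ ->|rewrite bigcup_set1].
Qed.

Lemma locally_finite_nbhd_open (X : choiceType) (V : set X) (Q : quiver X) :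
  finite_set V -> open [set Q' : lf_quiver X | lambda V Q' = lambda V Q].
Proof.
by move=> Vfin; exists [set (Q, V)]; [move=> _ ->|rewrite bigcup_set1].
Qed.

Lemma open_arrow_finite (X : Type) (O : set (quiver X)) (Q : quiver X) :
  open O -> O Q ->
  exists2 V, finite_set V & forall Q', rho V Q' = rho V Q -> O Q'.
Proof.
move=> [D DI <-] [[Q0 V] DV /= QV]; exists V; first exact: DI DV.
by move=> Q' e; exists (Q0, V) => //; rewrite /arrow_finite_nbhd /= e.
Qed.

Lemma open_locally_finite (X : choiceType) (O : set (lf_quiver X))
    (Q : lf_quiver X) : open O -> O Q ->
  exists2 V, finite_set V &
    forall Q' : lf_quiver X, lambda V Q' = lambda V Q -> O Q'.
Proof.
move=> [D DI <-] [[Q0 V] DV /= QV]; exists V; first exact: DI DV.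
by move=> Q' e; exists (Q0, V) => //; rewrite /locally_finite_nbhd /= e.
Qed.

(** * Planting a copy of a finite quiver *)

Lemma finite_set_disjoint_copy (T : countType) (V W : set T) :
  infinite_set [set: T] -> finite_set V -> finite_set W ->
  exists2 f : T -> T, bijective f & forall x, V x -> ~ W (f x).
Proof.
move=> Tinf Vfin Wfin.
have : (V #<= ~` W)%card.
  apply: card_le_trans (countableP V) _.
  by apply/infiniteP; rewrite -setTD; exact: infinite_setD.
have [x0 _] := infinite_setN0 Tinf.
pose pT : pointedType := HB.pack T (isPointed.Build T x0).
move=> /(@pcard_leP T pT)/unsquash g.
have [f fbij fg] := extend_injection Tinf Vfin (@inj _ _ _ g).
by exists f => // x Vx; rewrite fg //; exact: (@funS _ _ V (~` W) g).
Qed.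

(** [S] is a copy of [rho V Q] moved off [W], so splicing leaves it intact as a full subquiver and
    heredity excludes [P]. The finite rows of [S] preserve local finiteness. *)
Lemma not_property_splice (P : set AF) (V W : set posnat) (Q Q' : AF) :
  quiver_property P -> hereditary P ->
  finite_set V -> ~ P (rho V Q) -> finite_set W ->
  exists2 S : AF, ~ P (splice W Q' S) &
    forall x, finite_set [set y | S x y != 0%R].
Proof.
move=> P_property P_hereditary Vfin PQ Wfin.
have [f fbij fW] := finite_set_disjoint_copy infinite_posnat Vfin Wfin.
have [h fK hK] := fbij.
have fVfin : finite_set (f @` V) by exact: finite_image.
pose S := rho (f @` V) (pullback h Q).
exists S.
  move=> /(P_hereditary _ _ fVfin) PS; apply: PQ; apply: P_property PS.
  apply/isomorphic_sym/isomorphic_rho => // x y Vx Vy.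
  rewrite /= (memNset (fW _ Vx)) (memNset (fW _ Vy)) /=.
  by rewrite (mem_set (imageP f Vx)) (mem_set (imageP f Vy)) /= !fK.
move=> x; apply: sub_finite_set fVfin => y /=.
by case: (boolP (y \in f @` V)) => [/set_mem//|_]; rewrite andbF eqxx.
Qed.

Lemma locally_finite_splice (X : choiceType) (W : set X) (Q S : quiver X) :
  locally_finite Q -> (forall x, finite_set [set y | S x y != 0%R]) ->
  locally_finite (splice W Q S).
Proof.
move=> Qlf Sfin x; apply/(summable_intP _ (splice W Q S x)).
have /(summable_intP _ (Q x)) Qfin := Qlf x.
have : finite_set ([set y | Q x y != 0%R] `|` [set y | S x y != 0%R]).
  by rewrite finite_setU.
apply: sub_finite_set => y /=.
by case: ifP => _ ?; [left|right].
Qed.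

(** The elements of [fset_set V] form the finite vertex type that [fin_quiver] requires. *)
Lemma finite_induced_fin_quiver (X : choiceType) (V : set X) (Q : quiver X) :
  finite_set V -> exists G : fin_quiver, isomorphic (Defs.induced V Q) G.
Proof.
move=> Vfin.
exists (FinQuiver (pullback (fun u : fset_set V => val u) Q)).
have VF (u : set_type V) : val u \in fset_set V.
  by rewrite in_fset_set //; exact: valP.
have FV (u : fset_set V) : val u \in V.
  by rewrite -in_fset_set //; exact: valP.
exists (fun u => [` VF u]%fset) => //.
by exists (fun u => SigSub (FV u)) => u; exact: val_inj.
Qed.

(** A forbidden subquiver on [V] persists in every quiver that agrees with [Q] on [V], so the
    complement is open. *)
Lemma avoiding_closed (F : unlabeled_quiver -> Prop) : closed (avoiding F).
Proof.
rewrite -openC openE => Q /contrapT[V [Vfin [C FC [G CG QG]]]].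
rewrite /interior nbhsE /=.
exists [set Q' : AF | rho V Q' = rho V Q].
  by split=> //; exact: arrow_finite_nbhd_open.
move=> Q' /rho_eqP e /=; apply; exists V; split=> //; exists C => //.
exists G => //; apply: isomorphic_trans QG.
exists id; first by exists id.
by move=> x y /=; rewrite e //; exact: set_mem (valP _).
Qed.

Lemma closed_avoiding (P : set AF) :
  quiver_property P -> hereditary P -> closed P ->
  P = avoiding (fun C => exists V Q, [/\ finite_set V, ~ P (rho V Q) &
    exists2 G, representative C G & isomorphic (Defs.induced V Q) G]).
Proof.
move=> P_property P_hereditary Pcl; apply/seteqP; split=> [Q PQ|Q QF].
  move=> [V [Vfin [C [W [Q' [Wfin PQ' [G' CG' QG']]]] [G CG QG]]]].
  apply: PQ'; apply: P_property (P_hereditary _ _ Vfin PQ).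
  apply: (induced_isomorphic_rho infinite_posnat) => //.
  (* [G] and [G'] represent the same class [C], so both are isomorphic to [G0]. *)
  have [G0 CE] := representativeP C; move: CG CG'; rewrite CE => CG CG'.
  apply: isomorphic_trans QG _; apply: isomorphic_trans (isomorphic_sym QG').
  exact: isomorphic_trans (isomorphic_sym CG) CG'.
apply: contrapT => PQ; apply: QF.
have Pop : open (~` P) by rewrite openC.
have [V Vfin VP] := open_arrow_finite Pop PQ.
have [G QG] := finite_induced_fin_quiver Q Vfin.
exists V; split=> //.
have CP : exists G', isomorphism_class G = isomorphism_class G' by exists G.
exists (UnlabeledQuiver CP); last by exists G => //; exists id => //; exists id.
(* [rho V Q] itself lies in the neighbourhood of [Q] that misses [P]. *)
exists V, Q; split=> //; first by apply: VP; rewrite rho_idem.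
by exists G => //; exists id => //; exists id.
Qed.

Unset Implicit Arguments.
Set Strict Implicit.

Theorem theorem1p2 (P : set AF)
  (P_property : quiver_property P)
  (P_hereditary : hereditary P)
  (P_proper : exists2 Q : AF, finite_quiver Q & ~ P Q) :
  [/\ ~ dense [set Q : LF | P Q] /\ ~ dense P,
      dense [set Q : LF | ~ P Q] /\ dense (~` P) &
      (exists F : unlabeled_quiver -> Prop, P = avoiding F) <-> closed P].
Proof.
have [Q Qfin PQ] := P_proper.
have [V Vfin QV] := finite_quiver_rho Qfin.
(* Makes [Q] a point of [LF], so that its neighbourhood there, disjoint from [P], is nonempty. *)
have Qlf : locally_finite Q.
  move=> x; apply/(summable_intP _ (Q x)).
  apply: sub_finite_set Vfin => y /=; rewrite -QV rhoE.
  by case: (boolP (y \in V)) => [/set_mem//|_]; rewrite andbF eqxx.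
have PQV : ~ P (rho V Q) by rewrite QV.
have Pnbhd Q' : rho V Q' = rho V Q -> ~ P Q'.
  by move=> e /(P_hereditary _ _ Vfin); rewrite e.
split; first split.
- move/(_ [set Q' : LF | lambda V Q' = lambda V Q]) => [].
  + by exists (LfQuiver Qlf).
  + exact: locally_finite_nbhd_open.
  + by move=> Q' [/rho_lambda_eq/Pnbhd].
- move/(_ [set Q' : AF | rho V Q' = rho V Q]) => [].
  + by exists Q.
  + exact: arrow_finite_nbhd_open.
  + by move=> Q' [/Pnbhd].
- split=> O [Q' OQ'] Oop.
  + have [W Wfin WO] := open_locally_finite Oop OQ'.
    have [S PS Sfin] :=
      not_property_splice Q' P_property P_hereditary Vfin PQV Wfin.
    have Slf := locally_finite_splice W (lf_valP Q') Sfin.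
    exists (LfQuiver Slf); split=> //.
    (* The splice agrees with [Q'] on all arrows meeting [W], hence lies in [O]. *)
    by apply: WO; exact: lambda_splice.
  + have [W Wfin WO] := open_arrow_finite Oop OQ'.
    have [S PS _] :=
      not_property_splice Q' P_property P_hereditary Vfin PQV Wfin.
    exists (splice W Q' S); split=> //.
    by apply: WO; apply: rho_lambda_eq; exact: lambda_splice.
- split=> [[F ->]|Pcl]; first exact: avoiding_closed.
  by eexists; exact: closed_avoiding.
Qed.
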